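(* For every $s\in\{0,\dots,n\}$, the restriction of the edge labeling $\lambda$ to the cover relations of the subposet $P_{n,s}\subseteq\Pi_n^B$ is an EL-labeling of $P_{n,s}$ (the intersection lattice of $\mathcal D_{n,s}$).
   Context: $\Pi_n^B$ is the set of partitions $\pi$ of $\{-n,\dots,n\}$ such that (1) $B\in\pi$ implies $-B\in\pi$, and (2) if $i,-i\in B$ for some $i$ and some block $B$, then $0\in B$; ordered by refinement ($x\preceq y$ iff each block of $x$ lies in a block of $y$), graded by $r(\pi)=n-(|\pi|-1)/2$. It is isomorphic to the intersection lattice of the arrangement $\mathcal B_n$. The zero block $x_0$ of $x$ is the block containing $0$. $P_{n,s}$ is the subposet of all $\pi\in\Pi_n^B$ having no block equal to $\{k,0,-k\}$ for any $k\in\{s+1,\dots,n\}$, with the restricted rank function; it is isomorphic to the intersection lattice of $\mathcal D_{n,s}$ (normals $e_i\pm e_j$, $i<j$, and $e_i$, $i\le s$). For a block $R$, its representative $r(R)$ is the least $i\in[n]$ with $i\in R$ or $-i\in R$; $R$ is normalized if $r(R)\in R$. A cover relation $x\prec\!\!\cdot\,y$ is signed if $x_0\subsetneq y_0$; coherent if $R\cup R'\in y$ for some distinct normalized non-zero blocks $R,R'\in x$; non-coherent if $R\cup(-R')\in y$ for some distinct normalized non-zero blocks $R,R'\in x$. The labeling: if $x\prec\!\!\cdot\,y$ is unsigned with merged blocks $R,R'\in x$ having representatives $i,j$, then $\lambda(x,y)=(0,\max(i,j))$ if coherent and $(2,\min(i,j))$ if non-coherent; if signed, $\lambda(x,y)=(1,1)$.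 Labels are ordered lexicographically. A maximal chain of an interval is increasing if its label sequence is strictly increasing. An EL-labeling of a bounded ranked poset is an edge labeling such that every closed interval $[x,y]$ has a unique increasing maximal chain, and this chain's label sequence lexicographically precedes that of every other maximal chain of $[x,y]$. *)

(* Defs.v *)
From HB Require Import structures.
From mathcomp Require Import all_boot all_order all_algebra.

Set Implicit Arguments.
Unset Strict Implicit.
Unset Printing Implicit Defensive.

Import Order.TTheory GRing.Theory.

Section ELLabelings.
Local Open Scope order_scope.

Context {d : Order.disp_t} {T : finPOrderType d}.
Implicit Types (x y z : T) (c : seq T).

Definition covers x y : bool := (x < y) && [forall z, ~~ ((x < z) && (z < y))].

Definition bounded_poset : Prop :=
  (exists b : T, forall x, b <= x) /\ (exists t : T, forall x, x <= t).

Definition rank_function (rk : T -> nat) : Prop :=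
  (forall x, (forall z, ~~ (z < x)) -> rk x = 0%N) /\
  (forall x y, covers x y -> rk y = (rk x).+1).

(* The maximal chain x = z_0, z_1, ..., z_k = y of the closed interval [x, y],
   consecutive terms being cover relations, is represented by the sequence
   c = [:: z_1; ...; z_k], which omits its least element x. *)
Definition maximal_chain x y c : bool := path covers x c && (last x c == y).

Context {d' : Order.disp_t} {L : porderType d'}.
Implicit Type lam : T -> T -> L.

Definition label_seq lam x c : seqlexi L := pairmap lam x c.

Definition increasing_chain lam x c : bool :=
  sorted <%O (label_seq lam x c : seq L).

(* Only the values of lam on cover relations matter. *)
Definition EL_labeling (rk : T -> nat) lam : Prop :=
  [/\ bounded_poset,
      rank_function rk
    & forall x y, x <= y ->
      exists c, [/\ maximal_chain x y c,
                    increasing_chain lam x c,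
                    forall c', maximal_chain x y c' ->
                      increasing_chain lam x c' -> c' = c
                  & forall c', maximal_chain x y c' -> c' <> c ->
                      label_seq lam x c < label_seq lam x c']].

End ELLabelings.

(* The ordinal i < 2n + 1 stands for the integer i - n, so that the type is
   {-n, ..., n}. *)
Definition sint (n : nat) := 'I_n.*2.+1.

Definition sint_val n (i : sint n) : int := (Posz i - Posz n)%R.

Definition sint0 n : sint n := inord n.

(* The integer k, meaningful for k <= n. *)
Definition sint_of_nat n (k : nat) : sint n := inord (n + k).

Definition sintN n (i : sint n) : sint n := rev_ord i.

Lemma sint_val_inj n : injective (@sint_val n).
Proof. by move=> i j /addIr [] /val_inj. Qed.

Lemma sint_val_nat n k : k <= n -> sint_val (sint_of_nat n k) = Posz k.
Proof.
move=> le_kn; have lt_nk : n + k < n.*2.+1 by rewrite ltnS -addnn leq_add2l.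
by rewrite /sint_val /sint_of_nat inordK // PoszD addrC addKr.
Qed.

Lemma sint_val0 n : sint_val (sint0 n) = 0%R.
Proof. by rewrite /sint0 -[n in inord n]addn0 sint_val_nat. Qed.

Lemma sint_valN n (i : sint n) : sint_val (sintN i) = (- sint_val i)%R.
Proof.
have le_i : i <= n.*2 by rewrite -ltnS ltn_ord.
rewrite /sint_val /= subSS -subzn // opprB.
have -> : Posz n.*2 = (Posz n + Posz n)%R by rewrite -PoszD addnn.
by rewrite addrAC addrK.
Qed.

Definition blockN n (B : {set sint n}) : {set sint n} := [set sintN i | i in B].

Definition is_PiB n (pi : {set {set sint n}}) : bool :=
  [&& partition pi [set: sint n],
      [forall B in pi, blockN B \in pi]
    & [forall B in pi, [exists i in B, sintN i \in B] ==> (sint0 n \in B)]].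

Record PiB (n : nat) := MkPiB {
  PiB_blocks :> {set {set sint n}};
  PiB_prop : is_PiB PiB_blocks }.

HB.instance Definition _ n := [isSub for @PiB_blocks n].
HB.instance Definition _ n := [Finite of PiB n by <:].

Definition refines n (x y : PiB n) : bool :=
  [forall A in PiB_blocks x, exists B in PiB_blocks y, A \subset B].

Lemma refines_refl n : reflexive (@refines n).
Proof. by move=> x; apply/'forall_implyP=> A xA; apply/exists_inP; exists A. Qed.

Lemma refines_trans n : transitive (@refines n).
Proof.
move=> y x z /'forall_implyP xy /'forall_implyP yz.
apply/'forall_implyP=> A /xy /exists_inP[B /yz /exists_inP[C zC sBC] sAB].
by apply/exists_inP; exists C => //; apply: subset_trans sBC.
Qed.

Lemma refines_anti n : antisymmetric (@refines n).
Proof.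
suff sub (x y : PiB n) : refines x y -> refines y x ->
    PiB_blocks x \subset PiB_blocks y.
  move=> x y /andP[xy yx]; apply/val_inj/eqP.
  by rewrite eqEsubset /= !sub.
move=> /'forall_implyP xy /'forall_implyP yx; apply/subsetP=> A xA.
have /and3P[/and3P[_ tx x0] _ _] := PiB_prop x.
have /exists_inP[B yB sAB] := xy A xA.
have /exists_inP[C xC sBC] := yx B yB.
have sAC := subset_trans sAB sBC.
suff eAC : A = C by rewrite (_ : A = B) //; apply/eqP; rewrite eqEsubset sAB eAC.
apply/eqP; apply: contraNT x0 => neAC.
have /trivIsetP/(_ A C xA xC neAC) := tx.
by rewrite -setI_eq0 (setIidPl sAC) => /eqP <-.
Qed.

Fact PiB_display : Order.disp_t. Proof. exact: Order.Disp tt tt. Qed.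

HB.instance Definition _ n :=
  Order.Le_isPOrder.Build PiB_display (PiB n)
    (@refines_refl n) (@refines_anti n) (@refines_trans n).

(* #|x| is odd: besides the zero block, the blocks come in pairs B, -B. *)
Definition PiB_rank n (x : PiB n) : nat :=
  n - #|PiB_blocks x|.-1./2.

Definition is_P n (s : nat) (x : PiB n) : bool :=
  [forall k : 'I_n.+1, (s < k) ==>
     ([set sint_of_nat n k; sint0 n; sintN (sint_of_nat n k)] \notin PiB_blocks x)].

Record P (n s : nat) := MkP { P_val :> PiB n; P_prop : is_P s P_val }.

HB.instance Definition _ n s := [isSub for @P_val n s].
HB.instance Definition _ n s := [Finite of P n s by <:].
HB.instance Definition _ n s :=
  [SubChoice_isSubPOrder of P n s by <: with PiB_display].

Section Labeling.
Variable n : nat.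
Implicit Types (x y : PiB n) (R : {set sint n}).

Definition zero_block x : {set sint n} := pblock x (sint0 n).

(* The default value 0 is only reached when R is empty or {0}. *)
Definition representative R : nat :=
  head 0 [seq i <- iota 1 n | (sint_of_nat n i \in R) || (sintN (sint_of_nat n i) \in R)].

Definition normalized R : bool := sint_of_nat n (representative R) \in R.

Definition signed x y : bool := zero_block x \proper zero_block y.

Definition normalized_pair x (p : {set sint n} * {set sint n}) : bool :=
  [&& p.1 \in PiB_blocks x, p.2 \in PiB_blocks x, p.1 != p.2,
      sint0 n \notin p.1, sint0 n \notin p.2, normalized p.1 & normalized p.2].

Definition coherent_pair x y p : bool :=
  normalized_pair x p && (p.1 :|: p.2 \in PiB_blocks y).

Definition noncoherent_pair x y p : bool :=
  normalized_pair x p && (p.1 :|: blockN p.2 \in PiB_blocks y).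

(* An unsigned cover relation merges exactly one pair of normalized non-zero
   blocks, up to exchanging them, and is either coherent or non-coherent. The
   final default value is not taken on cover relations. *)
Definition lambda x y : nat *l nat :=
  if signed x y then (1, 1)
  else if [pick p | coherent_pair x y p] is Some p then
    (0, maxn (representative p.1) (representative p.2))
  else if [pick p | noncoherent_pair x y p] is Some p then
    (2, minn (representative p.1) (representative p.2))
  else (0, 0).

End Labeling.

(* Main.v *)
(* An element x of Pi_n^B is encoded by the map [crep x] sending u to the
   element of least absolute value in its block; such maps are exactly the odd
   idempotent maps that do not increase absolute values, and x <= y means
   crep y o crep x = crep y.  A cover relation sends a positive fixed point j
   to a fixed point e with |e| < j, and its label is (0, j), (1, 1) or (2, |e|)
   according to the sign of e.  In an interval [x, y] the move (j, e) of least
   label is unique; every move available after it has a larger label, and any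
   other first move leaves a move whose label is not larger than its own.
   Hence the greedy chain is the only increasing one, and it is
   lexicographically first.  The least move never leaves P_{n,s}: if it
   absorbs R and -R into the zero block, then no coherent move exists in
   [x, y], so R and -R are all that the zero block of y gains over that of x,
   and the result has the same zero block as y. *)
Require Import Defs.
From mathcomp Require Import all_boot all_order all_algebra zify.

Set Implicit Arguments.
Unset Strict Implicit.
Unset Printing Implicit Defensive.

Import Order.TTheory.

(** * A local criterion for EL-labelings *)

Section Criterion.
Local Open Scope order_scope.
Context {d : Order.disp_t} {T : finPOrderType d}.
Context {d' : Order.disp_t} {L : orderType d'}.
Variable lam : T -> T -> L.

Lemma maximal_chain_le (x y : T) c : maximal_chain x y c -> x <= y.
Proof.
case/andP=> pc /eqP <- {y}; elim: c x pc => //= z c IH x /andP[/andP[xz _] /IH].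
exact: le_trans (ltW xz).
Qed.

Lemma maximal_chain_cons (x y z : T) c :
  maximal_chain x y (z :: c) = covers x z && maximal_chain z y c.
Proof. by rewrite /maximal_chain /= andbA. Qed.

Lemma maximal_chain_refl (x : T) c : maximal_chain x x c -> c = [::].
Proof.
case: c => // z c; rewrite maximal_chain_cons => /andP[/andP[xz _]].
by move/maximal_chain_le => zx; have := lt_le_trans xz zx; rewrite ltxx.
Qed.

(** The last two clauses localize the comparison of whole chains: the first of them prevents a chain
    through another atom [z] from increasing, and the second lets [a] be put in front of an
    increasing chain of [[a, y]]. *)
Definition preferred_atom (x y a : T) : Prop :=
  [/\ covers x a, a <= y,
      forall z, covers x z -> z <= y -> z <> a -> lam x a < lam x z,
      forall z, covers x z -> z <= y -> z <> a ->
        exists w, [/\ covers z w, w <= y & lam z w <= lam x z]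
    & forall b, covers a b -> b <= y -> lam x a < lam a b].

(** By induction on the number of elements above [x], the increasing chain is [a] followed by that
    of [[a, y]]. An increasing chain through [z <> a] would have an increasing, hence
    lexicographically first, tail, whose first label is at most [lam z w <= lam x z]. *)
Lemma preferred_atoms_EL :
  (forall x y : T, x < y -> exists a, preferred_atom x y a) ->
  forall x y : T, x <= y ->
    exists c, [/\ maximal_chain x y c,
                  increasing_chain lam x c,
                  forall c', maximal_chain x y c' ->
                    increasing_chain lam x c' -> c' = c
                & forall c', maximal_chain x y c' -> c' <> c ->
                    label_seq lam x c < label_seq lam x c'].
Proof.
move=> atomP x y; have [m] := ubnP #|[set z | x < z]|.
elim: m x => // m IHm x lt_m; rewrite le_eqVlt => /orP[/eqP <-|xy].
  exists [::]; split=> //; first by rewrite /maximal_chain /=.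
  - by move=> c' /maximal_chain_refl.
  - by move=> c' /maximal_chain_refl.
have cardlt z : x < z -> (#|[set w | (z < w)%O]| < m)%N.
  move=> xz; move: lt_m; rewrite ltnS; apply: leq_trans; apply: proper_card.
  apply/properP; split; last by exists z; rewrite !inE ?ltxx.
  by apply/subsetP=> w; rewrite !inE; apply: lt_trans.
have {IHm lt_m cardlt} IH z xz := IHm z (cardlt z xz).
have [a [xa ay amin apre anext]] := atomP _ _ xy.
have ltc (u v : T) : covers u v -> u < v by case/andP.
have [c [cmax cinc cuni clex]] := IH a (ltc _ _ xa) ay.
exists (a :: c); split.
- by rewrite maximal_chain_cons xa.
- move: cmax cinc; case: (c) => [|b c'] //; rewrite maximal_chain_cons.
  rewrite /increasing_chain /= => /andP[ab /maximal_chain_le b_y] ->.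
  by rewrite anext.
- case=> [|z c'].
    by rewrite /maximal_chain /= => /eqP xey; rewrite xey ltxx in xy.
  rewrite maximal_chain_cons => /andP[xz zmax] cinc'.
  have zy := maximal_chain_le zmax.
  have zinc : increasing_chain lam z c' by apply: path_sorted cinc'.
  have [za|/eqP za] := eqVneq z a.
    by rewrite za (cuni c') // -za.
  have [w [zw wy lzw]] := apre z xz zy za.
  have xw := lt_trans (ltc _ _ xz) (ltc _ _ zw).
  have [c1 [_ _ c0uni c0lex]] := IH z (ltc _ _ xz) zy.
  (* By uniqueness in [[z, y]] the tail [c'] is [c1], so it inherits lexicographic minimality. It is
     compared with a chain starting at [w], for which any completion [c2] will do. *)
  rewrite -(c0uni c' zmax zinc) in c0lex.
  have [c2 [c2max _ _ _]] := IH w xw wy.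
  have wmax : maximal_chain z y (w :: c2) by rewrite maximal_chain_cons zw.
  case: c' zmax cinc' {zinc} c0lex => [|b c'] zmax cinc' c0lex.
    have zw' := lt_le_trans (ltc _ _ zw) wy.
    by move: zmax zw'; rewrite /maximal_chain /= => /eqP ->; rewrite ltxx.
  have bw : lam z b <= lam z w.
    have [[-> _]|/eqP ne] := eqVneq (w :: c2) (b :: c'); first by [].
    by have := c0lex _ wmax ne; rewrite /label_seq /= ltxi_cons => /andP[].
  move: cinc'; rewrite /increasing_chain /= => /andP[lxz _].
  by have := lt_le_trans lxz (le_trans bw lzw); rewrite ltxx.
- case=> [|z c'].
    by rewrite /maximal_chain /= => /eqP xey; rewrite xey ltxx in xy.
  rewrite maximal_chain_cons => /andP[xz zmax] ne.
  have zy := maximal_chain_le zmax.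
  rewrite /label_seq /= ltxi_cons.
  have [za|/eqP za] := eqVneq z a; last first.
    by have lxz := amin z xz zy za; rewrite (ltW lxz) leNgt lxz.
  subst z; rewrite lexx /=; apply: clex => // eqc; by rewrite eqc in ne.
Qed.

End Criterion.

(** * Canonical representatives *)

Section Sint.
Variable n : nat.
Implicit Types (u v w : sint n).

Lemma sintNK : involutive (@sintN n).
Proof. exact: rev_ordK. Qed.

Lemma sint_eq u v : (u = v) <-> (sint_val u = sint_val v).
Proof. by split=> [->|/sint_val_inj]. Qed.

Lemma sint_val_le u : `|sint_val u| <= n.
Proof. have := ltn_ord u; rewrite /sint_val; lia. Qed.

Lemma sintN0 : sintN (sint0 n) = sint0 n.
Proof. by apply: sint_val_inj; rewrite sint_valN sint_val0. Qed.

Lemma sint_of_abs u : (0 <= sint_val u)%R -> sint_of_nat n `|sint_val u| = u.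
Proof.
move=> u0; apply: sint_val_inj; rewrite sint_val_nat ?sint_val_le //; lia.
Qed.

Lemma eq_sintN0 u : sintN u = u -> u = sint0 n.
Proof. rewrite !sint_eq sint_valN sint_val0; lia. Qed.

End Sint.

Definition crep n (x : PiB n) (u : sint n) : sint n :=
  [arg min_(w < u in pblock x u) `|sint_val w|].

Definition canonical_form n (f : sint n -> sint n) : Prop :=
  [/\ forall u, f (sintN u) = sintN (f u), forall u, f (f u) = f u
    & forall u, `|sint_val (f u)| <= `|sint_val u|].

Section Crep.
Variable n : nat.
Implicit Types (x y : PiB n) (u v w : sint n) (f : sint n -> sint n).

Lemma PiB_partition x : partition x [set: sint n].
Proof. by have /and3P[] := PiB_prop x. Qed.

Lemma PiB_trivIset x : trivIset x.
Proof. by have /and3P[] := PiB_partition x. Qed.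

Lemma mem_PiB_cover x u : u \in cover x.
Proof. by have /and3P[/eqP-> _ _] := PiB_partition x; rewrite inE. Qed.

Lemma mem_PiB_block x u : u \in pblock x u.
Proof. by rewrite mem_pblock mem_PiB_cover. Qed.

Lemma PiB_block_in x u : pblock x u \in PiB_blocks x.
Proof. exact/pblock_mem/mem_PiB_cover. Qed.

Lemma eq_PiB_block x u v : (pblock x u == pblock x v) = (v \in pblock x u).
Proof. by rewrite eq_pblock ?PiB_trivIset ?mem_PiB_cover. Qed.

Lemma def_PiB_block x B u : B \in PiB_blocks x -> u \in B -> pblock x u = B.
Proof. exact/def_pblock/PiB_trivIset. Qed.

Lemma mem_blockN (B : {set sint n}) u : (u \in blockN B) = (sintN u \in B).
Proof. by rewrite -[u in LHS]sintNK mem_imset //; apply: (can_inj (@sintNK n)). Qed.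

Lemma PiB_blockN x u : pblock x (sintN u) = blockN (pblock x u).
Proof.
apply: def_PiB_block; last by rewrite mem_blockN sintNK mem_PiB_block.
have /and3P[_ /forall_inP + _] := PiB_prop x; apply; exact: PiB_block_in.
Qed.

Lemma PiB_zero_block x u : sintN u \in pblock x u -> sint0 n \in pblock x u.
Proof.
have /and3P[_ _ /forall_inP /(_ _ (PiB_block_in x u)) /implyP ok] := PiB_prop x.
by move=> Nu; apply: ok; apply/exists_inP; exists u => //; apply: mem_PiB_block.
Qed.

Lemma crep_spec x u :
  crep x u \in pblock x u /\
  (forall w, w \in pblock x u -> `|sint_val (crep x u)| <= `|sint_val w|).
Proof. by rewrite /crep; case: arg_minnP => //; apply: mem_PiB_block. Qed.

Lemma crep_block x u : crep x u \in pblock x u. Proof. by case: (crep_spec x u). Qed.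

(** Two elements of least absolute value agree up to sign, and opposite ones would put 0 into the
    block, so both would be 0. *)
Lemma crep_uniq x u v : v \in pblock x u ->
  (forall w, w \in pblock x u -> `|sint_val v| <= `|sint_val w|) -> crep x u = v.
Proof.
have [cu cmin] := crep_spec x u => vu vmin.
have := vmin _ cu; have := cmin _ vu => le1 le2.
have [//|Nv] : crep x u = v \/ crep x u = sintN v.
  rewrite !sint_eq sint_valN; lia.
have /eqP e : pblock x u == pblock x v by rewrite eq_PiB_block.
have : sint0 n \in pblock x u by rewrite e PiB_zero_block // -e -Nv.
move/vmin; rewrite sint_val0 Nv !sint_eq sint_valN; lia.
Qed.

Lemma eq_crep x u v : (crep x u = crep x v) <-> (v \in pblock x u).
Proof.
split=> [e|vu]; last first.
  have /eqP e : pblock x u == pblock x v by rewrite eq_PiB_block.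
  have [cv cmin] := crep_spec x v; rewrite -e in cv cmin; exact: crep_uniq.
have /eqP e1 : pblock x u == pblock x (crep x u) by rewrite eq_PiB_block crep_block.
have /eqP e2 : pblock x v == pblock x (crep x v) by rewrite eq_PiB_block crep_block.
by rewrite e1 e -e2 mem_PiB_block.
Qed.

Lemma crep_canonical x : canonical_form (crep x).
Proof.
split=> u.
- have [cu cmin] := crep_spec x u.
  apply: crep_uniq; first by rewrite PiB_blockN mem_blockN sintNK.
  move=> w; rewrite PiB_blockN mem_blockN => /cmin.
  by rewrite !sint_valN !abszN.
- by apply/esym/eq_crep/crep_block.
- by have [_] := crep_spec x u; apply; apply: mem_PiB_block.
Qed.

Lemma crepN x u : crep x (sintN u) = sintN (crep x u).
Proof. by have [] := crep_canonical x. Qed.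

Lemma crepK x u : crep x (crep x u) = crep x u.
Proof. by have [] := crep_canonical x. Qed.

Lemma crep_le x u : `|sint_val (crep x u)| <= `|sint_val u|.
Proof. by have [] := crep_canonical x. Qed.

Lemma crep0 x : crep x (sint0 n) = sint0 n.
Proof. by have := crep_le x (sint0 n); rewrite sint_eq sint_val0; lia. Qed.

Lemma in_PiB_block x u v : (v \in pblock x u) = (crep x u == crep x v).
Proof. by apply/idP/eqP=> /eq_crep. Qed.

(** The blocks are the fibres of [f]. Oddness makes them stable under negation, and
    [f (sintN u) = f u] forces [f u] to be 0, which is also [f] of 0; this is the zero block
    condition. *)
Lemma canonical_form_PiB f :
  canonical_form f -> exists x : PiB n, forall u, crep x u = f u.
Proof.
case=> fN fK fle; pose p := preim_partition f [set: sint n].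
have pP : partition p [set: sint n] by apply: preim_partitionP.
have tp : trivIset p by case/and3P: pP.
have cp u : u \in cover p by case/and3P: pP => /eqP->; rewrite inE.
have pb u v : (v \in pblock p u) = (f u == f v).
  by rewrite pblock_equivalence_partition ?inE // => a b c _ _ _; split=> // /eqP->.
have piP : is_PiB p.
  rewrite /is_PiB pP /=; apply/andP; split; apply/forall_inP=> B pB.
    have [u uB] : exists u, u \in B.
      by apply/set0Pn; apply: contraTneq pB => ->; case/and3P: pP.
    have eB : B = pblock p u by rewrite (def_pblock tp pB uB).
    suff -> : blockN B = pblock p (sintN u) by apply/pblock_mem/cp.
    apply/setP=> w; rewrite mem_blockN eB !pb fN.
    by rewrite -(inj_eq (can_inj (@sintNK n))) fN sintNK.
  apply/implyP=> /exists_inP[u uB]; rewrite -(def_pblock tp pB uB) !pb fN eq_sym.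
  move/eqP/eq_sintN0=> ->; have := fle (sint0 n).
  by rewrite eq_sym -(inj_eq (@sint_val_inj n)) sint_val0; lia.
exists (MkPiB piP) => u; apply: crep_uniq; rewrite /= ?pb ?fK //.
by move=> w; rewrite pb => /eqP->.
Qed.

Lemma crep_leP x y : reflect (forall u, crep y (crep x u) = crep y u) (x <= y)%O.
Proof.
apply: (iffP idP) => [/'forall_implyP xy u|xy].
  have /exists_inP[B yB /subsetP sB] := xy _ (PiB_block_in x u).
  apply/esym/eq_crep; rewrite (def_PiB_block yB (sB _ (mem_PiB_block x u))).
  exact/sB/crep_block.
apply/'forall_implyP=> A xA.
have [u uA] : exists u, u \in A.
  apply/set0Pn; apply: contraTneq xA => ->; by have /and3P[] := PiB_partition x.
apply/exists_inP; exists (pblock y u); first exact: PiB_block_in.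
rewrite -(def_PiB_block xA uA); apply/subsetP=> w; rewrite !in_PiB_block => /eqP e.
by rewrite -[crep y u]xy e xy.
Qed.

Lemma crep_inj x y : (forall u, crep x u = crep y u) -> x = y.
Proof.
by move=> e; apply/le_anti/andP; split; apply/crep_leP=> u; rewrite ?e crepK // -?e.
Qed.

(** Applying [crep y] to [crep x u] gives back [u], so no absolute value can drop on the way; a
    change of sign would give [u = sintN u]. *)
Lemma crep_fix_le x y u : (x <= y)%O -> crep y u = u -> crep x u = u.
Proof.
move=> /crep_leP xy yu; have := xy u; rewrite yu => e.
have := crep_le y (crep x u); have := crep_le x u; rewrite e => le1 le2.
have [//|Nu] : crep x u = u \/ crep x u = sintN u by rewrite !sint_eq sint_valN; lia.
by move: e; rewrite Nu crepN yu => /eq_sintN0 ->; rewrite sintN0.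
Qed.

Lemma crep_fix_lt x u : crep x u <> u -> `|sint_val (crep x u)| < `|sint_val u|.
Proof.
move=> ne; have := crep_le x u; rewrite leq_eqVlt => /orP[/eqP e|//].
have Nu : crep x u = sintN u by move: ne; rewrite !sint_eq sint_valN; lia.
case: ne; have := crepK x u; rewrite Nu crepN Nu => /eq_sintN0 e0.
by rewrite e0; move: e0; rewrite !sint_eq sint_valN sint_val0; lia.
Qed.

End Crep.

(** * Moves *)

Section Moves.
Variable n : nat.
Implicit Types (x y z : PiB n) (u v w : sint n) (p q r : sint n * sint n).

(** The pairs [(j, e)] and [(-j, -e)] describe the same merge; asking for [0 < j] keeps one of them.
    The sign of [e] then tells coherent, signed and non-coherent merges apart. *)
Definition mergeable x p : bool :=
  [&& (0 < sint_val p.1)%R, crep x p.1 == p.1, crep x p.2 == p.2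
    & `|sint_val p.2| < `|sint_val p.1|].

Definition merge_fun p w : sint n :=
  if w == p.1 then p.2 else if w == sintN p.1 then sintN p.2 else w.

Definition is_merge x p z : Prop := forall u, crep z u = merge_fun p (crep x u).

Lemma mergeableP x p :
  reflect [/\ (0 < sint_val p.1)%R, crep x p.1 = p.1, crep x p.2 = p.2
            & `|sint_val p.2| < `|sint_val p.1|] (mergeable x p).
Proof.
apply: (iffP and4P) => [[h1 /eqP h2 /eqP h3 h4]|[h1 h2 h3 h4]];
  by split=> //; apply/eqP.
Qed.

Lemma mergeable_neqN x p : mergeable x p -> sintN p.1 <> p.1.
Proof. by case/mergeableP=> p1 _ _ _; rewrite sint_eq sint_valN; lia. Qed.

Lemma merge_fun1 p : merge_fun p p.1 = p.2.
Proof. by rewrite /merge_fun eqxx. Qed.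

Lemma merge_fun1N x p : mergeable x p -> merge_fun p (sintN p.1) = sintN p.2.
Proof.
by move/mergeable_neqN/eqP/negbTE; rewrite /merge_fun => ->; rewrite eqxx.
Qed.

Lemma merge_fun_id p w : w <> p.1 -> w <> sintN p.1 -> merge_fun p w = w.
Proof. by rewrite /merge_fun => /eqP/negbTE-> /eqP/negbTE->. Qed.

Variant merge_fun_spec p w : sint n -> Type :=
| MergeFun1 of w = p.1 : merge_fun_spec p w p.2
| MergeFunN of w = sintN p.1 : merge_fun_spec p w (sintN p.2)
| MergeFunId of w <> p.1 & w <> sintN p.1 : merge_fun_spec p w w.

Lemma merge_funP p w : merge_fun_spec p w (merge_fun p w).
Proof.
rewrite /merge_fun; case: eqP => [->|n1]; first by constructor.
by case: eqP => [->|n2]; constructor.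
Qed.

Lemma merge_funN x p w : mergeable x p -> merge_fun p (sintN w) = sintN (merge_fun p w).
Proof.
move=> px; case: (merge_funP p w) => [->|->|n1 n2]; first exact: merge_fun1N px.
  by rewrite sintNK merge_fun1 sintNK.
apply: merge_fun_id => e; [apply: n2|apply: n1];
  by rewrite -?e ?sintNK // -[w]sintNK e sintNK.
Qed.

Lemma merge_fun0 x p : mergeable x p -> merge_fun p (sint0 n) = sint0 n.
Proof.
case/mergeableP=> p1 _ _ _; apply: merge_fun_id => /sint_eq;
  rewrite ?sint_valN sint_val0; lia.
Qed.

Lemma exists_merge x p : mergeable x p -> exists z, is_merge x p z.
Proof.
move=> px; apply: (@canonical_form_PiB n (fun u => merge_fun p (crep x u))).
have [p1 f1 f2 lt21] := mergeableP _ _ px.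
have m2 : merge_fun p p.2 = p.2.
  by apply: merge_fun_id => /sint_eq; rewrite ?sint_valN; lia.
split=> u.
- by rewrite crepN (merge_funN _ px).
- case: (merge_funP p (crep x u)) => [_|_|n1 n2].
  + by rewrite f2 m2.
  + by rewrite crepN f2 (merge_funN _ px) m2.
  + by rewrite crepK merge_fun_id.
- apply: leq_trans (crep_le x u).
  by case: (merge_funP p (crep x u)) => // ->; rewrite ?sint_valN; lia.
Qed.

Section Merge.
Variables (x z : PiB n) (p : sint n * sint n).
Hypotheses (px : mergeable x p) (xz : is_merge x p z).

Lemma merge_le : (x <= z)%O.
Proof. by apply/crep_leP=> u; rewrite !xz crepK. Qed.

Lemma merge_fix1 : crep z p.1 = p.2.
Proof. by have [_ f1 _ _] := mergeableP _ _ px; rewrite xz f1 merge_fun1. Qed.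

Lemma merge_fixP u : crep z u = u <-> [/\ crep x u = u, u <> p.1 & u <> sintN p.1].
Proof.
have [p1 f1 f2 lt21] := mergeableP _ _ px.
split=> [zu|[xu n1 n2]]; last by rewrite xz xu merge_fun_id.
have xu := crep_fix_le merge_le zu; split=> // e; move: zu; rewrite e ?crepN merge_fix1.
  by move/sint_eq; lia.
by move/sint_eq; rewrite !sint_valN; lia.
Qed.

(** Only [p.1] and its negative are moved, and oddness of [crep y] takes care of the latter. *)
Lemma merge_le_iff y : (x <= y)%O -> (z <= y)%O = (crep y p.1 == crep y p.2).
Proof.
move=> /crep_leP xy; apply/crep_leP/eqP => [zy|e u]; first by rewrite -zy merge_fix1.
rewrite xz -[RHS]xy; case: (merge_funP p (crep x u)) => [->|->|] //.
by rewrite !crepN e.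
Qed.

Lemma merge_lt : (x < z)%O.
Proof.
rewrite lt_neqAle merge_le andbT; apply/eqP=> e.
have [p1 f1 f2 lt21] := mergeableP _ _ px.
by have := merge_fix1; rewrite -e f1 => /sint_eq; lia.
Qed.

(** All representatives of [z] are fixed by [crep y], so only the image of [p.1] is in doubt: if it
    is fixed then [y = x], otherwise [y = z]. *)
Lemma merge_between y : (x <= y)%O -> (y <= z)%O -> y = x \/ y = z.
Proof.
move=> xy yz; have [p1 f1 f2 lt21] := mergeableP _ _ px.
have fixy u : crep x u = u -> u <> p.1 -> u <> sintN p.1 -> crep y u = u.
  by move=> xu n1 n2; apply: (crep_fix_le yz); apply/merge_fixP.
have [y1|/eqP y1] := eqVneq (crep y p.1) p.1; [left|right];
  apply: crep_inj => u; rewrite -(crep_leP _ _ xy u).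
  have [->//|/eqP n1] := eqVneq (crep x u) p.1.
  have [->|/eqP n2] := eqVneq (crep x u) (sintN p.1); first by rewrite crepN y1.
  by apply: fixy => //; apply: crepK.
have yp : crep y p.1 = p.2.
  (* The image of [p.1] under [crep y] is a representative of [x] of smaller absolute value, so it
     survives in [z] and must be [p.2]. *)
  rewrite -merge_fix1 -(crep_leP _ _ yz); apply/esym/merge_fixP.
  have yt := crepK y p.1; split; first exact: crep_fix_le xy yt.
    exact: y1.
  by have := crep_fix_lt y1 => lty /sint_eq; rewrite sint_valN; lia.
rewrite xz; case: (merge_funP p (crep x u)) => [->|->|n1 n2] //.
  by rewrite crepN yp.
by apply: fixy => //; apply: crepK.
Qed.

End Merge.

Lemma is_merge_uniq x p z z' : is_merge x p z -> is_merge x p z' -> z = z'.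
Proof. by move=> xz xz'; apply: crep_inj => u; rewrite xz xz'. Qed.

(** * Labels of moves and the least move of an interval *)

Definition move_label p : nat *l nat :=
  if (0 < sint_val p.2)%R then (0, `|sint_val p.1|)
  else if sint_val p.2 == 0%R then (1, 1) else (2, `|sint_val p.2|).

Variant move_label_spec p : nat *l nat -> Type :=
| CoherentMove of (0 < sint_val p.2)%R : move_label_spec p (0, `|sint_val p.1|)
| SignedMove of sint_val p.2 = 0%R : move_label_spec p (1, 1)
| NoncoherentMove of (sint_val p.2 < 0)%R : move_label_spec p (2, `|sint_val p.2|).

Lemma move_labelP p : move_label_spec p (move_label p).
Proof.
rewrite /move_label; case: ifP => [|h1]; first by constructor.
by case: eqP => [|h2]; constructor=> //; lia.
Qed.

Lemma leqlexi_pair (a b c d : nat) :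
  (((a, b) : nat *l nat) <= (c, d))%O = (a < c) || (a == c) && (b <= d).
Proof. rewrite lexi_pair !leEnat; lia. Qed.

Lemma ltnlexi_pair (a b c d : nat) :
  (((a, b) : nat *l nat) < (c, d))%O = (a < c) || (a == c) && (b < d).
Proof. rewrite ltxi_pair !leEnat ltEnat /=; lia. Qed.

(* The result of a move need not lie in [P n s]; that of a least move does. *)
Definition move x y p : bool := mergeable x p && (crep y p.1 == crep y p.2).

Lemma moveP x y p :
  reflect [/\ (0 < sint_val p.1)%R, crep x p.1 = p.1, crep x p.2 = p.2,
              `|sint_val p.2| < `|sint_val p.1| & crep y p.1 = crep y p.2]
    (move x y p).
Proof.
apply: (iffP andP) => [[/mergeableP[? ? ? ?] /eqP]|[? ? ? ? /eqP]];
  by split=> //; apply/mergeableP.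
Qed.

Definition least_move x y p : Prop :=
  move x y p /\ forall q, move x y q -> (move_label p <= move_label q)%O.

Lemma exists_move x y : (x < y)%O -> exists p, move x y p.
Proof.
rewrite lt_neqAle => /andP[/eqP ne xy].
have [u neu] : exists u, crep x u != crep y u.
  apply/existsP; apply/negbNE/negP=> /existsPn h; apply: ne; apply: crep_inj => u.
  by have /negbNE/eqP := h u.
have [|] := boolP (move x y (crep x u, crep y u)); first by exists (crep x u, crep y u).
(* The pair for [u] can fail to be a move only by having a non-positive first entry, so its negative
   is a move. *)
move=> nm; exists (sintN (crep x u), sintN (crep y u)).
have e := crep_leP _ _ xy u.
have yfix := crep_fix_le xy (crepK y u).
have lt : `|sint_val (crep y u)| < `|sint_val (crep x u)|.
  rewrite -e; apply: crep_fix_lt; rewrite e => e'; by rewrite e' eqxx in neu.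
have pos : (sint_val (crep x u) <= 0)%R.
  rewrite leNgt; apply: contra nm => p; apply/moveP; split=> //=.
  - exact: crepK.
  - by rewrite e crepK.
apply/moveP; split; rewrite /= ?sint_valN ?crepN ?crepK ?yfix ?e //; lia.
Qed.

Lemma exists_least_move x y : (x < y)%O -> exists p, least_move x y p.
Proof.
case/exists_move=> p0 mp0.
have [p mp pmin] := @arg_minP _ _ _ p0 (move x y) move_label mp0.
by exists p.
Qed.

Lemma coherent_move x y u v : crep x u = u -> crep x v = v ->
  (0 < sint_val u)%R -> (sint_val u < sint_val v)%R -> crep y u = crep y v ->
  move x y (v, u).
Proof. by move=> *; apply/moveP; split=> //=; lia. Qed.

(** Moves with equal labels share one entry: the first if coherent, the second otherwise. If their
    other entries differed, these would be positive representatives merged in [y], or, in the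
    coherent case, second entries below [p.1]; either way a coherent move of smaller label would
    exist. *)
Lemma least_move_lt x y p q :
  least_move x y p -> move x y q -> q <> p -> (move_label p < move_label q)%O.
Proof.
case=> mp pmin mq ne; rewrite lt_neqAle pmin // andbT; apply/eqP=> elab; apply: ne.
have [p1 fp1 fp2 ltp ep] := moveP _ _ _ mp.
have [q1 fq1 fq2 ltq eq] := moveP _ _ _ mq.
have nocoh u v : crep x u = u -> crep x v = v ->
    (0 < sint_val u)%R -> (0 < sint_val v)%R -> crep y u = crep y v ->
    (((0, maxn `|sint_val u| `|sint_val v|) : nat *l nat) < move_label p)%O -> u = v.
  move=> xu xv u0 v0 e.
  have [h|h|/sint_eq //] := ltgtP (sint_val u) (sint_val v) => /lt_le_trans lt.
    have := lt _ (pmin _ (coherent_move xu xv u0 h e)).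
    by rewrite /move_label /= u0 ltnlexi_pair; lia.
  have := lt _ (pmin _ (coherent_move xv xu v0 h (esym e))).
  by rewrite /move_label /= v0 ltnlexi_pair; lia.
suff [e1 e2] : q.1 = p.1 /\ q.2 = p.2.
  by move: e1 e2; case: (q) (p) => [? ?] [? ?] /= -> ->.
move: elab nocoh; case: (move_labelP p) => hp; case: (move_labelP q) => hq elab nocoh;
  have := congr1 fst elab; have := congr1 snd elab => //= e _.
- have e1 : q.1 = p.1 by rewrite sint_eq; lia.
  split=> //; apply: nocoh => //; first by rewrite -eq e1.
  by rewrite ltnlexi_pair; lia.
- have e2 : q.2 = p.2 by rewrite sint_eq hp.
  by split=> //; apply: nocoh => //; rewrite eq e2.
- have e2 : q.2 = p.2 by rewrite sint_eq; lia.
  by split=> //; apply: nocoh => //; rewrite eq e2.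
Qed.

(** A move from [z] is already a move from [x], since representatives of [z] are representatives of
    [x]; it is not [p], because [p.1] has been merged away. *)
Lemma least_move_next x y z p q : least_move x y p -> is_merge x p z ->
  move z y q -> (move_label p < move_label q)%O.
Proof.
move=> lp xz /moveP[q1 fq1 fq2 ltq eq]; have /andP[px _] := lp.1.
have [xq1 nq1 _] := (merge_fixP px xz _).1 fq1.
have [xq2 _ _] := (merge_fixP px xz _).1 fq2.
by apply: (least_move_lt lp) => [|e]; [apply/moveP|rewrite e in nq1].
Qed.

(** The larger of the two absolute values is sent to the smaller, giving a non-coherent move; if
    they are equal, [v] is the negative of [u] and both lie in the zero block of [y]. *)
Lemma move_absorb x y u v : crep x u = u -> crep x v = v ->
  (0 < sint_val u)%R -> (sint_val v < 0)%R -> crep y u = crep y v ->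
  exists2 r, move x y r & (move_label r <= ((2, `|sint_val v|) : nat *l nat))%O.
Proof.
move=> xu xv u0 v0 e; have := crepN y; have := crepN x => xN yN.
have [h|h|h] := ltngtP `|sint_val u| `|sint_val v|.
- exists (sintN v, sintN u).
    by apply/moveP; rewrite /= !xN xu xv !yN e !sint_valN; split=> //; lia.
  case: move_labelP; rewrite /= sint_valN ?leqlexi_pair; lia.
- exists (u, v); first by apply/moveP; split=> //=.
  case: move_labelP; rewrite /= ?leqlexi_pair; lia.
- have vu : v = sintN u by rewrite sint_eq sint_valN; lia.
  exists (u, sint0 n); last by rewrite /move_label /= sint_val0 leqlexi_pair.
  apply/moveP; split=> //=; rewrite ?crep0 ?sint_val0 //; first lia.
  by apply: eq_sintN0; rewrite -yN -vu.
Qed.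

(** If [p] and [q] send the same element to two targets, a move between these targets remains.
    Otherwise [p] itself remains available, unless its target is the element removed by [q]; then
    [p.1] can be sent to [q.2]. *)
Lemma least_move_prefer x y z p q : least_move x y p -> move x y q -> q <> p ->
  is_merge x q z -> exists2 r, move z y r & (move_label r <= move_label q)%O.
Proof.
move=> lp mq ne xz; have lt := least_move_lt lp mq ne; have [mp _] := lp.
have [p1 fp1 fp2 ltp ep] := moveP _ _ _ mp.
have [q1 fq1 fq2 ltq eq] := moveP _ _ _ mq.
have /andP[qx _] := mq.
have fixz u : crep x u = u -> `|sint_val u| != `|sint_val q.1| -> crep z u = u.
  move=> xu nu; apply/(merge_fixP qx xz); split=> // e; move: nu;
    by rewrite e ?sint_valN; lia.
have zq2 : crep z q.2 = q.2 by apply: fixz => //; lia.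
have [e1|n1] := eqVneq p.1 q.1.
  have zp2 : crep z p.2 = p.2 by apply: fixz; rewrite // -e1; lia.
  have e2 : crep y p.2 = crep y q.2 by rewrite -ep -eq e1.
  (* With [p] of smaller label five type combinations survive; coherent with coherent is impossible,
     as both labels are determined by the common first entry. *)
  move: lt; case: (move_labelP p) => hp; case: (move_labelP q) => hq;
    rewrite ltnlexi_pair //= => lt.
  - by rewrite e1 in lt; lia.
  - exists (p.2, q.2); last by rewrite /move_label /= hq leqlexi_pair.
    by apply/moveP; split=> //=; lia.
  - exact: (move_absorb zp2 zq2 hp hq e2).
  - exists (sintN q.2, sint0 n); last by rewrite /move_label /= sint_val0 leqlexi_pair.
    have p20 : p.2 = sint0 n by rewrite sint_eq sint_val0.
    apply/moveP; rewrite /= !crepN -e2 zq2 p20 !crep0 sintN0 sint_val0 sint_valN.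
    by split=> //; lia.
  - exists (sintN q.2, sintN p.2).
      by apply/moveP; rewrite /= !crepN zp2 zq2 e2 !sint_valN; split=> //; lia.
    by case: move_labelP; rewrite /= sint_valN ?leqlexi_pair; lia.
have {}n1 : sint_val p.1 <> sint_val q.1 by move/sint_eq/eqP; rewrite (negbTE n1).
have zp1 : crep z p.1 = p.1 by apply: fixz => //; lia.
have [e2|n2] := eqVneq `|sint_val p.2| `|sint_val q.1|; last first.
  by exists p; [apply/moveP; split=> //; apply: fixz | apply: ltW].
(* A negative [p.2] would give [q] a non-coherent label with [|p.2| < |q.2| < |q.1|], against
   [|p.2| = |q.1|]. *)
have [hp|hp] := leP (sint_val p.2) 0%R.
  move: lt; case: (move_labelP p) => hp'; case: (move_labelP q) => hq;
    rewrite ltnlexi_pair //=; lia.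
have p2 : p.2 = q.1 by rewrite sint_eq; lia.
exists (p.1, q.2).
  by apply/moveP; split=> //=; [lia|rewrite -eq -p2].
move: lt; rewrite /move_label /= hp; case: ifP => _; first by rewrite ltnlexi_pair; lia.
by [].
Qed.

(** * Membership in the subposet *)

(** A zero block has the forbidden shape exactly when it has a single positive element and that
    element exceeds [s]. *)
Lemma is_PP (s : nat) x :
  reflect (forall u, (s%:Z < sint_val u)%R -> crep x u = sint0 n ->
             exists v, [/\ v <> u, (0 < sint_val v)%R & crep x v = sint0 n])
    (is_P s x).
Proof.
have zb u : (u \in pblock x (sint0 n)) = (crep x u == sint0 n).
  by rewrite in_PiB_block crep0 eq_sym.
apply: (iffP forallP) => [xP u su xu|xP k].
  have kn : `|sint_val u| < n.+1 by rewrite ltnS sint_val_le.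
  have nin : [set u; sint0 n; sintN u] \notin PiB_blocks x.
    have := xP (Ordinal kn); rewrite /= sint_of_abs; last lia.
    by move/implyP; apply; lia.
  have [/existsP[v /and3P[/eqP ? ? /eqP ?]]|/existsPn nv] :=
    boolP [exists v, [&& v != u, (0 < sint_val v)%R & crep x v == sint0 n]].
    by exists v.
  case/negP: nin; suff -> : [set u; sint0 n; sintN u] = pblock x (sint0 n).
    exact: PiB_block_in.
  apply/setP=> w; rewrite !inE zb; apply/idP/idP.
    by case/orP=> [/orP[]|] /eqP->; rewrite ?crepN ?xu ?crep0 ?sintN0.
  move=> xw; have := nv w; have := nv (sintN w).
  rewrite crepN (eqP xw) sintN0 eqxx !andbT -!(inj_eq (@sint_val_inj n)).
  rewrite !sint_valN sint_val0; lia.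
apply/implyP=> sk; apply/negP=> Bx.
have kn : k <= n by rewrite -ltnS ltn_ord.
set u := sint_of_nat n k in Bx.
have eB : pblock x (sint0 n) = [set u; sint0 n; sintN u].
  by apply: def_PiB_block => //; rewrite !inE eqxx orbT.
have vu : sint_val u = k by rewrite sint_val_nat.
have xu : crep x u = sint0 n by apply/eqP; rewrite -zb eB !inE eqxx.
have su : (s%:Z < sint_val u)%R by rewrite vu; lia.
have [v [vnu v0]] := xP u su xu.
move/eqP; rewrite -zb eB !inE (negbTE (introN eqP vnu)) -!(inj_eq (@sint_val_inj n)).
rewrite sint_valN sint_val0; lia.
Qed.

Lemma least_move_is_P s x y z p : is_P s x -> is_P s y -> (x <= y)%O ->
  least_move x y p -> is_merge x p z -> is_P s z.
Proof.
move=> /is_PP xP /is_PP yP xy [mp pmin] xz; apply/is_PP => u su zu.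
have /andP[px /eqP ep] := mp.
have [p1 f1 f2 lt21] := mergeableP _ _ px.
have [xu|/eqP xu] := eqVneq (crep x u) (sint0 n).
  have [v [nvu v0 xv]] := xP u su xu; exists v; split=> //.
  by rewrite xz xv (merge_fun0 px).
have p20 : p.2 = sint0 n.
  move: zu; rewrite xz; case: (merge_funP p (crep x u)) => // _ e.
  by rewrite -[p.2]sintNK e sintN0.
have zy : (z <= y)%O by rewrite (merge_le_iff px xz xy) ep.
have yu : crep y u = sint0 n by rewrite -(crep_leP _ _ zy) zu crep0.
have [v [nvu v0 yv]] := yP u su yu; exists v; split=> //.
rewrite xz; case: (merge_funP p (crep x v)) => [_|_|n1 n2]; rewrite ?p20 ?sintN0 //.
have [//|/eqP xv] := eqVneq (crep x v) (sint0 n).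
have ypv : crep y p.1 = sint0 n by rewrite ep p20 crep0.
have yxv : crep y (crep x v) = sint0 n by rewrite (crep_leP _ _ xy).
(* Were [v] still outside the zero block of [z], its representative in [x], up to sign, would be a
   second positive one absorbed by the zero block of [y]. Merging it with [p.1] is coherent, hence
   of label below [(1, 1)]. *)
have [w [xw w0 wn yw]] : exists w,
    [/\ crep x w = w, (0 < sint_val w)%R, w <> p.1 & crep y w = sint0 n].
  have [h|h] := ltP 0%R (sint_val (crep x v)).
    by exists (crep x v); split=> //; apply: crepK.
  exists (sintN (crep x v)); split.
  - by rewrite crepN crepK.
  - by move: xv; rewrite sint_eq sint_valN sint_val0; lia.
  - by move=> e; case: n2; rewrite -e sintNK.
  - by rewrite crepN yxv sintN0.
have labp : move_label p = (1, 1) by rewrite /move_label p20 sint_val0.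
have [h|h|/sint_eq //] := ltgtP (sint_val w) (sint_val p.1).
- have /pmin : move x y (p.1, w) by apply: coherent_move => //; rewrite ypv.
  by rewrite labp /move_label /= w0 leqlexi_pair.
- have /pmin : move x y (w, p.1) by apply: coherent_move => //; rewrite ypv.
  by rewrite labp /move_label /= p1 leqlexi_pair.
Qed.

End Moves.

(** * Labels and ranks of moves *)

Section Lambda.
Variable n : nat.
Implicit Types (x y z : PiB n) (u v w : sint n) (p q : sint n * sint n).

Lemma head_filter_iota (a : pred nat) m : 0 < m <= n -> a m ->
  (forall i, 0 < i < m -> ~~ a i) -> head 0 [seq i <- iota 1 n | a i] = m.
Proof.
move=> /andP[m0 mn] am amin.
have -> : n = m.-1 + (n - m).+1 by lia.
rewrite iotaD filter_cat (_ : filter a (iota 1 m.-1) = [::]) /=.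
  by have -> : 1 + m.-1 = m by [lia]; rewrite am.
apply/eqP; rewrite -size_eq0 size_filter -leqn0 leqNgt -has_count -all_predC.
by apply/allP=> i; rewrite mem_iota /= => ?; apply: amin; lia.
Qed.

Lemma representative_block x u : crep x u <> sint0 n ->
  representative (pblock x u) = `|sint_val (crep x u)|.
Proof.
move=> nz; apply: head_filter_iota; first by have := sint_val_le (crep x u);
  move: nz; rewrite sint_eq sint_val0; lia.
  have [h|h] := leP 0%R (sint_val (crep x u)).
    by rewrite sint_of_abs // crep_block.
  apply/orP; right; rewrite -abszN -sint_valN sint_of_abs ?sintNK ?crep_block //.
  by rewrite sint_valN; lia.
move=> i /andP[i0 im]; have := sint_val_le (crep x u) => mn.
have vi : sint_val (sint_of_nat n i) = i by rewrite sint_val_nat //; lia.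
have [_ cmin] := crep_spec x u.
by apply/negP=> /orP[] /cmin; rewrite ?sint_valN vi; lia.
Qed.

Lemma normalized_block x i : crep x i = i -> (0 < sint_val i)%R ->
  [/\ sint0 n \notin pblock x i, normalized (pblock x i)
    & representative (pblock x i) = `|sint_val i|].
Proof.
move=> xi i0; have ni : crep x i <> sint0 n by rewrite xi sint_eq sint_val0; lia.
have er := representative_block ni; rewrite xi in er ni; split=> //.
  by rewrite in_PiB_block xi crep0; apply/eqP.
by rewrite /normalized er sint_of_abs ?mem_PiB_block //; lia.
Qed.

(** Normalized non-zero blocks correspond to positive fixed points of [crep x], which turns
    statements about pairs of blocks into arithmetic. *)
Lemma normalized_pairP x (P : {set sint n} * {set sint n}) :
  reflect (exists i j, [/\ P = (pblock x i, pblock x j), crep x i = i, crep x j = j,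
                           (0 < sint_val i)%R /\ (0 < sint_val j)%R & i <> j])
    (normalized_pair x P).
Proof.
have nb B : B \in PiB_blocks x -> sint0 n \notin B -> normalized B ->
    exists i, [/\ B = pblock x i, crep x i = i & (0 < sint_val i)%R].
  move=> xB B0 Bn; set i := sint_of_nat n (representative B).
  have eB : pblock x i = B by apply: def_PiB_block.
  have ci : crep x i <> sint0 n.
    by move=> e; case/negP: B0; rewrite -eB -e crep_block.
  have er : representative B = `|sint_val (crep x i)|.
    by rewrite -eB representative_block.
  have vi : sint_val i = `|sint_val (crep x i)|.
    by rewrite [in LHS]/i sint_val_nat er // sint_val_le.
  have c0 : sint_val (crep x i) <> 0%R by move: ci; rewrite sint_eq sint_val0.
  exists i; split=> //; last lia.
  have [//|/eqP/crep_fix_lt] := eqVneq (crep x i) i; lia.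
case: P => A B; apply: (iffP idP) => [|[i [j [[-> ->] xi xj [i0 j0] ij]]]].
  case/and5P=> /= xA xB neAB A0 /and3P[B0 An Bn].
  have [i [eA xi i0]] := nb A xA A0 An; have [j [eB xj j0]] := nb B xB B0 Bn.
  by exists i, j; rewrite eA eB; split=> // e; rewrite eA eB e eqxx in neAB.
have [Bi ni _] := normalized_block xi i0; have [Bj nj _] := normalized_block xj j0.
rewrite /normalized_pair /= !PiB_block_in Bi Bj ni nj /= andbT.
by rewrite eq_PiB_block in_PiB_block xi xj; apply/eqP.
Qed.

Lemma card_PiB_blocks x : #|PiB_blocks x| = #|[set u | crep x u == u]|.
Proof.
have <- : (fun u => pblock x u) @: [set u | crep x u == u] = PiB_blocks x.
  apply/setP=> B; apply/imsetP/idP=> [[u _ ->]|xB]; first exact: PiB_block_in.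
  have [u uB] : exists u, u \in B.
    by apply/set0Pn; apply: contraTneq xB => ->; have /and3P[] := PiB_partition x.
  exists (crep x u); first by rewrite inE crepK.
  by apply/esym/def_PiB_block => //; rewrite -(def_PiB_block xB uB) crep_block.
rewrite card_in_imset // => u v; rewrite !inE => /eqP xu /eqP xv /eqP.
by rewrite eq_PiB_block in_PiB_block xu xv => /eqP.
Qed.

Section MergeLabel.
Variables (x z : PiB n) (p : sint n * sint n).
Hypotheses (px : mergeable x p) (xz : is_merge x p z).

Lemma merge_signed : signed x z = (p.2 == sint0 n).
Proof.
have [p1 f1 f2 lt21] := mergeableP _ _ px.
rewrite /signed /zero_block; apply/properP/eqP.
  case=> _ [u]; rewrite !in_PiB_block !crep0 xz => /eqP e /eqP ne; move: e ne.
  by case: (merge_funP p (crep x u)) => // _ e _; rewrite -[p.2]sintNK -e sintN0.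
move=> p20; split.
  apply/subsetP=> u; rewrite !in_PiB_block !crep0 xz => /eqP <-.
  by rewrite (merge_fun0 px).
exists p.1; rewrite in_PiB_block crep0; first by rewrite (merge_fix1 px xz) p20.
by rewrite f1; apply/eqP=> /sint_eq; rewrite sint_val0; lia.
Qed.

Lemma merge_block : p.2 <> sint0 n -> pblock x p.1 :|: pblock x p.2 = pblock z p.2.
Proof.
move=> p20; have [p1 f1 f2 lt21] := mergeableP _ _ px.
have zp2 : crep z p.2 = p.2.
  by apply/(merge_fixP px xz); split=> // /sint_eq; rewrite ?sint_valN; lia.
apply/setP=> u; rewrite inE !in_PiB_block f1 f2 zp2 xz.
case: (merge_funP p (crep x u)) => [->|->|n1 n2]; rewrite ?eqxx //; last first.
  by rewrite (negbTE (introN eqP (nesym n1))).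
move: p20; rewrite -!(inj_eq (@sint_val_inj n)) sint_eq !sint_valN sint_val0; lia.
Qed.

(** Since [pick] returns an arbitrary pair, every witness has to yield the same label. Two distinct
    positive representatives of [x] with equal image under [crep z] can only be [p.1] and [p.2]. *)
Lemma coherent_merge (P : {set sint n} * {set sint n}) : coherent_pair x z P ->
  (0 < sint_val p.2)%R /\
  maxn (representative P.1) (representative P.2) = `|sint_val p.1|.
Proof.
have [p1 f1 f2 lt21] := mergeableP _ _ px.
case/andP=> /normalized_pairP[i [j [-> xi xj [i0 j0] ij]]] /= zB.
have [_ _ ->] := normalized_block xi i0; have [_ _ ->] := normalized_block xj j0.
have : crep z i = crep z j.
  apply/eq_crep; rewrite (def_PiB_block zB (u := i)) inE mem_PiB_block ?orbT //.
rewrite !xz xi xj; case: (merge_funP p i) => [ei|ei|n1 n2];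
  case: (merge_funP p j) => [ej|ej|n1' n2'] /sint_eq;
  move: ij; rewrite sint_eq; move: i0 j0; rewrite ?ei ?ej ?sint_valN; lia.
Qed.

Lemma noncoherent_merge (P : {set sint n} * {set sint n}) : noncoherent_pair x z P ->
  minn (representative P.1) (representative P.2) = `|sint_val p.2|.
Proof.
have [p1 f1 f2 lt21] := mergeableP _ _ px.
case/andP=> /normalized_pairP[i [j [-> xi xj [i0 j0] ij]]] /=.
rewrite -PiB_blockN => zB.
have [_ _ ->] := normalized_block xi i0; have [_ _ ->] := normalized_block xj j0.
have : crep z i = crep z (sintN j).
  apply/eq_crep; rewrite (def_PiB_block zB (u := i)) inE mem_PiB_block ?orbT //.
rewrite crepN !xz xi xj; case: (merge_funP p i) => [ei|ei|n1 n2];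
  case: (merge_funP p j) => [ej|ej|n1' n2'] /sint_eq;
  move: ij; rewrite sint_eq; move: i0 j0; rewrite ?ei ?ej ?sint_valN; lia.
Qed.

Lemma lambda_merge : lambda x z = move_label p.
Proof.
have [p1 f1 f2 lt21] := mergeableP _ _ px.
rewrite /lambda merge_signed -(inj_eq (@sint_val_inj n)) sint_val0.
case: (move_labelP p) => h.
- rewrite (_ : (sint_val p.2 == 0%R) = false); last lia.
  case: pickP => [P /coherent_merge[_ ->] //|/(_ (pblock x p.1, pblock x p.2))].
  case/negP; apply/andP; split; last first.
    by rewrite merge_block ?PiB_block_in // sint_eq sint_val0; lia.
  by apply/normalized_pairP; exists p.1, p.2; split=> // /sint_eq; lia.
- by rewrite h eqxx.
- rewrite (_ : (sint_val p.2 == 0%R) = false); last lia.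
  case: pickP => [P /coherent_merge[] |_]; first lia.
  case: pickP => [P /noncoherent_merge -> //|/(_ (pblock x p.1, pblock x (sintN p.2)))].
  case/negP; apply/andP; split; last first.
    rewrite /= -PiB_blockN sintNK merge_block ?PiB_block_in //.
    by rewrite sint_eq sint_val0; lia.
  apply/normalized_pairP; exists p.1, (sintN p.2); rewrite crepN f2 sint_valN.
  by split=> //; [lia|move/sint_eq; rewrite sint_valN; lia].
Qed.

(** Blocks are counted by their representatives, and a merge removes exactly [p.1] and its
    negative. *)
Lemma merge_rank : PiB_rank z = (PiB_rank x).+1.
Proof.
have [p1 f1 f2 lt21] := mergeableP _ _ px.
have cardx : #|[set u | crep x u == u]| = #|[set u | crep z u == u]|.+2.
  rewrite (cardsD1 p.1) (cardsD1 (sintN p.1)) !inE crepN f1 !eqxx /=.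
  rewrite (introN eqP (mergeable_neqN px)) /= !add1n; congr (_.+2).
  apply: eq_card => u; rewrite !inE; apply/and3P/eqP=> [[/eqP ? /eqP ? /eqP ?]|].
    by apply/(merge_fixP px xz).
  by case/(merge_fixP px xz)=> ? ? ?; split; apply/eqP.
(* This bound and the next keep the predecessor and the subtraction in [PiB_rank] from being
   truncated. *)
have z0 : 0 < #|[set u | crep z u == u]|.
  by apply/card_gt0P; exists (sint0 n); rewrite inE crep0.
have xle : #|[set u | crep x u == u]| <= n.*2.+1.
  by apply: leq_trans (max_card _) _; rewrite card_ord.
rewrite /PiB_rank !card_PiB_blocks cardx; move: z0 xle; rewrite cardx.
case: #|_| => // m _ /= ; lia.
Qed.

End MergeLabel.
End Lambda.

(** * The subposet *)

Section Subposet.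
Variables n s : nat.
Implicit Types (x y z : P n s) (p q : sint n * sint n).

Lemma P_leE x y : (x <= y)%O = (P_val x <= P_val y)%O.
Proof. by []. Qed.

Lemma P_ltE x y : (x < y)%O = (P_val x < P_val y)%O.
Proof. exact: ltEsub. Qed.

Lemma merge_covers x z p : mergeable (P_val x) p -> is_merge (P_val x) p (P_val z) ->
  covers x z.
Proof.
move=> px xz; rewrite /covers P_ltE (merge_lt px xz); apply/forallP=> w.
apply/negP=> /andP[]; rewrite !P_ltE => xw wz.
have [e|e] := merge_between px xz (ltW xw) (ltW wz); first by rewrite e ltxx in xw.
by rewrite e ltxx in wz.
Qed.

Lemma least_move_merge x y p : (x <= y)%O -> least_move (P_val x) (P_val y) p ->
  exists z : P n s, [/\ is_merge (P_val x) p (P_val z), covers x z & (z <= y)%O].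
Proof.
rewrite P_leE => xy lp; have [/andP[px ep] _] := lp.
have [z xz] := exists_merge px.
have zP := least_move_is_P (P_prop x) (P_prop y) xy lp xz.
exists (MkP zP); split=> //; first exact: (merge_covers px).
by rewrite P_leE /= (merge_le_iff px xz xy).
Qed.

(** The least move of [[x, z]] stays in the subposet and below [z], so its result is [z]: covers in
    the subposet are single merges. *)
Lemma coversP x z : covers x z ->
  exists2 p, mergeable (P_val x) p & is_merge (P_val x) p (P_val z).
Proof.
case/andP=> xz /forallP nb.
have [p lp] := exists_least_move (etrans (esym (P_ltE x z)) xz).
have [w [xw /andP[ltxw _] wz]] := least_move_merge (ltW xz) lp.
have [[/andP[px _] _]] := lp; exists p => //.
suff -> : z = w by [].
apply/eqP; have := nb w; rewrite ltxw /= lt_neqAle wz andbT negbK eq_sym //.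
Qed.

Lemma P_preferred_atom x y : (x < y)%O ->
  exists a, preferred_atom (fun x y => lambda (P_val x) (P_val y)) x y a.
Proof.
move=> ltxy; have xy := ltW ltxy; rewrite P_ltE in ltxy.
have [p lp] := exists_least_move ltxy.
have [a [xa cxa ay]] := least_move_merge xy lp.
have [/andP[px _] _] := lp.
have covermove u z : (z <= y)%O -> (u <= y)%O -> covers u z ->
    exists2 q, move (P_val u) (P_val y) q & is_merge (P_val u) q (P_val z).
  move=> zy uy /coversP[q qu uz]; exists q => //; rewrite /move qu.
  by rewrite -(merge_le_iff qu uz).
exists a; split=> // [z xz zy za|z xz zy za|b ab b_y].
- have [q mq xz'] := covermove x z zy xy xz; have /andP[qx _] := mq.
  rewrite (lambda_merge px xa) (lambda_merge qx xz').
  apply: (least_move_lt lp mq) => e; apply: za; apply: val_inj.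
  by rewrite e in xz'; apply: is_merge_uniq xz' xa.
- have [q mq xz'] := covermove x z zy xy xz; have /andP[qx _] := mq.
  have qp : q <> p.
    move=> e; rewrite e in xz'; apply: za;
    apply: val_inj; apply: is_merge_uniq xz' xa.
  have [r mr ler] := least_move_prefer lp mq qp xz'.
  have ltzy : (P_val z < P_val y)%O.
    rewrite -P_ltE lt_neqAle zy andbT; apply: contraTneq mr => ->.
    by apply/negP=> /moveP[r1 f1 f2 lt21]; rewrite f1 f2 => /sint_eq; lia.
  (* The move [r] might leave the subposet, so it is replaced by the least move of [[z, y]], whose
     label is no larger. *)
  have [r' lr'] := exists_least_move ltzy.
  have [w [zw czw wy]] := least_move_merge zy lr'.
  have [/andP[zr' _] r'min] := lr'.
  exists w; split=> //; rewrite (lambda_merge zr' zw) (lambda_merge qx xz').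
  exact: le_trans (r'min _ mr) ler.
- have [q mq ab'] := covermove a b b_y ay ab; have /andP[qa _] := mq.
  rewrite (lambda_merge px xa) (lambda_merge qa ab').
  exact: least_move_next lp xa mq.
Qed.

(** * Bounds and rank of the subposet *)

Lemma P_bottom :
  exists2 b : P n s, forall u, crep (P_val b) u = u & forall x, (b <= x)%O.
Proof.
have [|b eb] := @canonical_form_PiB n id; first by split.
have bP : is_P s b.
  by apply/is_PP=> u su; rewrite eb => /sint_eq; rewrite sint_val0; lia.
exists (MkP bP) => //= x; rewrite P_leE; apply/crep_leP => u /=; by rewrite eb.
Qed.

Lemma P_top : exists t : P n s, forall x, (x <= t)%O.
Proof.
have [t et] : exists t : PiB n, forall u, crep t u = sint0 n.
  apply: (@canonical_form_PiB n (fun=> sint0 n)); split=> u //; first by rewrite sintN0.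
  by rewrite sint_val0.
have [tP|ntP] := boolP (is_P s t).
  exists (MkP tP) => x; rewrite P_leE; apply/crep_leP => u /=; by rewrite !et.
(* The one-block partition is excluded only here; the subposet then reduces to its bottom
   element. *)
have [n1 s0] : n = 1 /\ s = 0.
  have [//|bad] : (n = 1 /\ s = 0) \/ (n <= s \/ 1 < n) by lia.
  case/negP: ntP; apply/is_PP=> u su _; have := sint_val_le u => un.
  (* A positive element other than [u]. *)
  pose k := if `|sint_val u| == 1 then 2 else 1.
  have kn : k <= n by rewrite /k; case: eqP; lia.
  exists (sint_of_nat n k); split=> //.
    by move/sint_eq; rewrite sint_val_nat // /k; case: eqP; lia.
  by rewrite sint_val_nat // /k; case: eqP.
have [b eb bx] := P_bottom; exists b => x; rewrite P_leE; apply/crep_leP=> u.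
rewrite !eb; have /is_PP xP := P_prop x.
have [//|/eqP/crep_fix_lt ne] := eqVneq (crep (P_val x) u) u.
have := sint_val_le u => un.
have xu : crep (P_val x) u = sint0 n by rewrite sint_eq sint_val0; lia.
have [w [w0 xw]] : exists w, (0 < sint_val w)%R /\ crep (P_val x) w = sint0 n.
  have [h|h] := ltP 0%R (sint_val u); first by exists u.
  by exists (sintN u); rewrite crepN xu sintN0 sint_valN; split=> //; lia.
have [|v [nv v0 _]] := xP w _ xw; first lia.
by case: nv; have := sint_val_le v; have := sint_val_le w; rewrite sint_eq; lia.
Qed.

Lemma P_rank_function : rank_function (fun x : P n s => PiB_rank (P_val x)).
Proof.
split=> [x xmin|x z /coversP[p px xz]]; last exact: merge_rank xz.
have [b eb bx] := P_bottom.
have <- : b = x by apply/eqP; have := xmin b; rewrite lt_neqAle bx andbT negbK.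
rewrite /PiB_rank card_PiB_blocks (_ : [set u | _] = [set: sint n]).
  by rewrite cardsT card_ord /= doubleK subnn.
by apply/setP=> u; rewrite !inE eb eqxx.
Qed.

End Subposet.

Theorem theorem4p23 (n s : nat) (hs : s <= n) :
  @EL_labeling _ (P n s) _ (nat *l nat)%type
    (fun x : P n s => PiB_rank (P_val x))
    (fun x y : P n s => lambda (P_val x) (P_val y)).
Proof.
split; last exact/preferred_atoms_EL/P_preferred_atom.
  by split; [have [b _ bx] := P_bottom n s; exists b | apply: P_top].
exact: P_rank_function.
Qed.
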